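(* Let $l\ge 1$ and let $A$ be an $l\times l$ Jordan block over $\mathbb{C}$ with an eigenvalue $\lambda$ satisfying $|\lambda|>1$, acting on $\mathbb{C}^l$. Then the following hold. (i) $J(0)=\mathbb{C}^l$, where $J(0)$ is taken under $A$. (ii) For every point $y\in\mathbb{C}^l$ there exists a sequence $\{x_n\}\subset\mathbb{C}^l$ such that $x_n\to 0$ and $A^n x_n\to y$; hence $J(0)=J^{mix}(0)$ (under $A$). (iii) For every linear map $B:\mathbb{C}^l\to\mathbb{C}^l$ all of whose eigenvalues have modulus greater than $1$, it holds that $J(0)=\mathbb{C}^l$, where $J(0)$ is taken under $B$.
   Context: An $l\times l$ Jordan block with eigenvalue $\lambda$ is the matrix with all main diagonal entries equal to $\lambda$, all entries on the diagonal just above the main diagonal equal to $1$, and all other entries $0$. For a linear map $T:\mathbb{C}^l\to\mathbb{C}^l$ and $x\in\mathbb{C}^l$, the extended limit set and the extended mixing limit set of $x$ under $T$ are $J(x)=\{y\in\mathbb{C}^l:$ there exist a strictly increasing sequence of positive integers $\{k_n\}$ and a sequence $\{x_n\}\subset\mathbb{C}^l$ such that $x_n\to x$ and $T^{k_n}x_n\to y\}$, $J^{mix}(x)=\{y\in\mathbb{C}^l:$ there exists a sequence $\{x_n\}\subset\mathbb{C}^l$ such that $x_n\to x$ and $T^{n}x_n\to y\}$. *)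

(* Defs.v *)
From HB Require Import structures.
From mathcomp Require Import all_boot all_order all_algebra.
From mathcomp Require Import all_classical all_reals all_analysis.
From mathcomp Require Import complex.

Set Implicit Arguments.
Unset Strict Implicit.
Unset Printing Implicit Defensive.

Import Order.TTheory GRing.Theory Num.Theory.
Import numFieldNormedType.Exports.
Local Open Scope ring_scope.
Local Open Scope complex_scope.
Local Open Scope classical_set_scope.

(* The norm topology of R[i]. The instances of numFieldNormedType only apply to
   abstract numeric fields, so that without this 'cV[R[i]]_l has no topology. *)
HB.instance Definition _ (R : realType) := NormedModule.copy R[i] (R[i])^o.

Definition extended_limit_set (X : topologicalType) (T : X -> X) (x : X) :
    set X :=
  [set y | exists (k : nat -> nat) (u : nat -> X),
    [/\ forall n, (0 < k n)%N,
        {homo k : m n / (m < n)%N},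
        u n @[n --> \oo] --> x &
        iter (k n) T (u n) @[n --> \oo] --> y]].

Definition extended_mixing_limit_set (X : topologicalType) (T : X -> X)
    (x : X) : set X :=
  [set y | exists u : nat -> X,
    u n @[n --> \oo] --> x /\ iter n T (u n) @[n --> \oo] --> y].

Definition jordan_block (K : pzRingType) (l : nat) (lambda : K) : 'M[K]_l :=
  \matrix_(i < l, j < l)
    if i == j then lambda else if j == i.+1 :> nat then 1 else 0.

(* Main.v *)
Require Import Defs.
From mathcomp Require Import all_boot all_order all_algebra.
From mathcomp Require Import all_classical all_reals all_analysis.
From mathcomp Require Import complex ring.

Import Order.TTheory GRing.Theory Num.Theory.
Import numFieldNormedType.Exports.
Local Open Scope ring_scope.
Local Open Scope complex_scope.
Local Open Scope classical_set_scope.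

(** A linear map [M] of a finite-dimensional complex space whose eigenvalues all
    have modulus greater than [1] is invertible, and its inverse contracts
    asymptotically: [M^-n y --> 0] for every [y].  The sequence [M^-n y] then
    shows that [y] lies in [J^mix(0)], because [M^n] sends its [n]-th term
    exactly to [y].  As [J^mix(0)] is always contained in [J(0)], both sets are
    the whole space.  A Jordan block is the case of a single eigenvalue, so the
    three assertions come from the same fact.

    The decay of [w n := M^-n y] is proved without the Jordan normal form and
    without a formula for the powers of a Jordan block.  By Cayley-Hamilton,
    [w] is killed by a product of factors [M - a], one for each root [a] of the
    characteristic polynomial.  Removing one factor replaces [w] by
    [z n := (M - a) w n], which is again a backward orbit of [M] and is killed
    by a shorter product; so [z --> 0] by induction ([backward_orbit_cvg0]).
    Since [M w n.+1 = w n], the definition of [z] reads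
    [w n.+1 = a^-1 w n - a^-1 z n.+1], which is a contracting recurrence with a
    vanishing perturbation ([contracting_recurrence_cvg0]), hence [w --> 0]. *)

Lemma cvg_expr_complex (R : realType) (b : R[i]) :
  `|b| < 1 -> b ^+ n @[n --> \oo] --> (0 : R[i]).
Proof.
move=> b1; apply/cvgr0Pnorm_lt => e e0.
(* In the order of [R[i]], a positive element is a positive real number, so that
   the claim is about the real sequence of moduli. *)
have eE : e = (complex.Re e)%:C.
  by case: e e0 => x y; rewrite ltcE /= => /andP[/eqP -> _].
have bE : `|b| = (Normc.normc b)%:C by [].
have e0' : 0 < complex.Re e by move: e0; rewrite ltcE => /andP[].
have c1 : `|Normc.normc b| < 1.
  have c0 : 0 <= Normc.normc b by case: (b) => x y; exact: sqrtr_ge0.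
  by rewrite ger0_norm// -ltcR -bE.
have /cvgr0Pnorm_lt/(_ _ e0') := @cvg_expr R _ c1.
apply: filterS => n /= cn; rewrite eE normrX bE -rmorphXn /= ltcR.
by rewrite (le_lt_trans _ cn)// ler_norm.
Qed.

(** After a rank [N] beyond which the perturbation [e] is below
    [d / 2 * (1 - `|b|)], the bound [d / 2] is stable under one more step, and
    what is left of [v N] decays geometrically. *)
Lemma contracting_recurrence_cvg0 (R : realType) (V : normedModType R[i])
    (b : R[i]) (v e : nat -> V) :
  `|b| < 1 -> (forall n, v n.+1 = b *: v n + e n) ->
  e n @[n --> \oo] --> (0 : V) -> v n @[n --> \oo] --> (0 : V).
Proof.
move=> b1 vS e_cvg; apply/cvgr0Pnorm_lt => d d0.
have d1b : 0 < d / 2 * (1 - `|b|) by rewrite mulr_gt0 ?divr_gt0 ?subr_gt0.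
have [N _ eN] := (cvgr0Pnorm_lt _).1 e_cvg _ d1b.
have bound k : `|v (N + k)%N| <= `|b ^+ k *: v N| + d / 2.
  elim: k => [|k IHk]; first by rewrite addn0 expr0 scale1r lerDl divr_ge0 ?ltW.
  rewrite addnS vS; apply: (le_trans (ler_normD _ _)).
  rewrite exprS -scalerA normrZ (normrZ b).
  have -> : `|b| * `|b ^+ k *: v N| + d / 2 =
     `|b| * (`|b ^+ k *: v N| + d / 2) + d / 2 * (1 - `|b|) by ring.
  by rewrite lerD ?ler_wpM2l// ltW// eN//= leq_addr.
have vN0 : b ^+ k *: v N @[k --> \oo] --> (0 : V).
  rewrite -[X in _ --> X](scale0r (v N)).
  by apply: cvgZl; exact: cvg_expr_complex.
have [K _ vK] := (cvgr0Pnorm_lt _).1 vN0 _ (divr_gt0 d0 (ltr0n _ 2)).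
exists (N + K)%N => // n /= NKn.
have Nn : (N <= n)%N by apply: leq_trans NKn; rewrite leq_addr.
rewrite -(subnKC Nn); apply: (le_lt_trans (bound _)).
by rewrite [ltRHS]splitr ltrD2r vK//= leq_subRL.
Qed.

(** The roots [s] are removed one at a time.  The orbit is a free variable of the
    induction because the step passes from [w] to [(M - a) w]; annihilation is
    assumed at every [n] so that the base case says that [w] vanishes. *)
Lemma backward_orbit_cvg0 (R : realType) (l : nat) (M : 'M[R[i]]_l.+1)
    (s : seq R[i]) (w : nat -> 'cV[R[i]]_l.+1) :
  {in s, forall a, 1 < `|a|} -> (forall n, M *m w n.+1 = w n) ->
  (forall n, horner_mx M (\prod_(a <- s) ('X - a%:P)) *m w n = 0) ->
  w n @[n --> \oo] --> (0 : 'cV[R[i]]_l.+1).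
Proof.
elim: s w => [|a s IHs] w s1 wS pw0.
  have w0 n : w n = 0 by rewrite -(pw0 n) big_nil rmorph1 mul1mx.
  by under eq_fun do rewrite w0; exact: cvg_cst.
have a1 : 1 < `|a| by apply: s1; rewrite mem_head.
have a0 : a != 0 by rewrite -normr_gt0 (lt_trans _ a1).
pose z n := horner_mx M ('X - a%:P) *m w n.
have zE n : z n = M *m w n - a *: w n.
  by rewrite /z rmorphB /= horner_mx_X horner_mx_C mulmxBl mul_scalar_mx.
have z0 : z n @[n --> \oo] --> (0 : 'cV[R[i]]_l.+1).
  apply: IHs => [c cs|n|n]; first by apply: s1; rewrite inE cs orbT.
    by rewrite !zE mulmxBr -scalemxAr !wS.
  by rewrite -[RHS](pw0 n) big_cons mulrC rmorphM; exact: mulmxA.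
apply: (@contracting_recurrence_cvg0 _ _ a^-1 _ (fun n => - a^-1 *: z n.+1)).
- by rewrite normfV invf_lt1 ?normr_gt0.
- move=> n; rewrite zE wS scaleNr scalerBr scalerA mulVf// scale1r opprB.
  by rewrite addrCA subrr addr0.
rewrite -[X in _ --> X](scaler0 _ (- a^-1)).
by apply: cvgZr; rewrite (cvg_shiftS z).
Qed.

(** The witness for [y] is [M^-n y], which [M^n] maps exactly to [y]. *)
Lemma expanding_mulmx_mixing (R : realType) (l : nat) (M : 'M[R[i]]_l.+1) :
  (forall a, root (char_poly M) a -> 1 < `|a|) ->
  extended_mixing_limit_set (mulmx M : 'cV_l.+1 -> 'cV_l.+1) 0 = setT.
Proof.
move=> M1; rewrite -subTset => y _.
have Munit : M \in unitmx.
  rewrite unitmxE unitfE; apply/negP => /eqP detM0.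
  have /M1 : root (char_poly M) 0.
    by rewrite /root horner_coef0 char_poly_det detM0 mulr0.
  by rewrite normr0 ltr10.
pose w n : 'cV[R[i]]_l.+1 := invmx M ^+ n *m y.
have wS n : M *m w n.+1 = w n.
  by rewrite /w exprS mulmxA mulmxA mulmxV// mul1mx.
exists w; split; last first.
  have iterw n : iter n (mulmx M) (w n) = y.
    elim: n => [|n IHn]; first by rewrite /w expr0 mul1mx.
    by rewrite iterSr wS IHn.
  by under eq_fun do rewrite iterw; exact: cvg_cst.
have [s charE] := closed_field_poly_normal (char_poly M).
rewrite (monicP (char_poly_monic M)) scale1r in charE.
apply: (@backward_orbit_cvg0 _ _ M s) => // [a sa|n].
  by apply: M1; rewrite charE root_prod_XsubC.
by rewrite -charE Cayley_Hamilton mul0mx.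
Qed.

Lemma extended_mixing_limit_set_sub (X : topologicalType) (T : X -> X) (x : X) :
  extended_mixing_limit_set T x `<=` extended_limit_set T x.
Proof.
move=> y [u [ux uy]].
(* The times have to be positive, so the index [0] is skipped. *)
exists S, (fun n => u n.+1); split=> //.
- exact: cvg_comp (cvg_addnl 1) ux.
- exact: cvg_comp (cvg_addnl 1) uy.
Qed.

Lemma char_poly_tr (K : comNzRingType) (n : nat) (M : 'M[K]_n) :
  char_poly M^T = char_poly M.
Proof.
rewrite /char_poly -det_tr; congr (\det _).
by apply/matrixP => i j; rewrite !mxE eq_sym.
Qed.

(** [char_poly_trig] is about lower triangular matrices, hence the transpose. *)
Lemma root_char_poly_jordan_block (K : fieldType) (l : nat) (lambda a : K) :
  root (char_poly (jordan_block l lambda)) a -> a = lambda.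
Proof.
rewrite -char_poly_tr char_poly_trig; last first.
  apply/is_trig_mxP => i j ij; rewrite !mxE.
  by rewrite -val_eqE /= gtn_eqF// ltn_eqF// ltnS ltnW.
under eq_bigr do rewrite !mxE eqxx.
rewrite prodr_const; case: #|_| => [|n].
  by rewrite expr0 (negPf (root1 _)).
by rewrite root_exp_XsubC => /eqP.
Qed.

Lemma lfun_cV_mulmx (K : fieldType) (l : nat) (B : 'End('cV[K]_l)) :
  B =1 mulmx (\matrix_(i, j) B (delta_mx j 0) i 0).
Proof.
move=> x; apply/matrixP => i j; rewrite ord1 mxE.
rewrite {1}(matrix_sum_delta x) linear_sum summxE; apply: eq_bigr => k _.
by rewrite big_ord1 linearZ /= !mxE mulrC.
Qed.

(** An [eigenvalue] of a matrix has a row eigenvector, whereas [mulmx M] acts on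
    columns; transposition exchanges the two and keeps the characteristic
    polynomial. *)
Lemma root_char_poly_leigenvalue (K : fieldType) (l : nat)
    (B : 'End('cV[K]_l)) (M : 'M[K]_l) (a : K) :
  B =1 mulmx M -> root (char_poly M) a -> passmx.leigenvalue B a.
Proof.
move=> BM; rewrite -char_poly_tr -eigenvalue_root_char.
move=> /eigenvalueP[v vM v0]; apply/eqP => kerB0.
have : v^T \in passmx.leigenspace B a.
  rewrite memv_ker !lfun_simp /= BM -[M]trmxK -trmx_mul vM linearZ /=.
  by rewrite subrr.
by rewrite kerB0 memv0 trmx_eq0 (negPf v0).
Qed.

Theorem theorem2p3 (R : realType) (l : nat) (hl : (1 <= l)%N)
    (lambda : R[i]) (hlambda : 1 < `|lambda|) :
  let A : 'cV[R[i]]_l -> 'cV[R[i]]_l := mulmx (jordan_block l lambda) in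
  [/\ extended_limit_set A 0 = [set: 'cV[R[i]]_l],
      (forall y : 'cV[R[i]]_l, exists u : nat -> 'cV[R[i]]_l,
         u n @[n --> \oo] --> (0 : 'cV[R[i]]_l) /\
         iter n A (u n) @[n --> \oo] --> y) /\
      extended_limit_set A 0 = extended_mixing_limit_set A 0 &
      forall B : 'End('cV[R[i]]_l),
        (forall a : R[i], passmx.leigenvalue B a -> 1 < `|a|) ->
        extended_limit_set B 0 = [set: 'cV[R[i]]_l]].
Proof.
case: l hl => // l _ A.
have mixA : extended_mixing_limit_set A 0 = setT.
  by apply: expanding_mulmx_mixing => a /root_char_poly_jordan_block ->.
have limT (T : 'cV[R[i]]_l.+1 -> 'cV[R[i]]_l.+1) :
    extended_mixing_limit_set T 0 = setT -> extended_limit_set T 0 = setT.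
  move=> mixT; rewrite -subTset -mixT.
  exact: extended_mixing_limit_set_sub.
split; first exact: limT.
  split; last by rewrite mixA limT.
  by move=> y; have : [set: 'cV[R[i]]_l.+1] y by []; rewrite -mixA.
move=> B B1; have BM := @lfun_cV_mulmx _ _ B.
apply: limT; rewrite (funext BM).
apply: expanding_mulmx_mixing => a aM.
exact/B1/root_char_poly_leigenvalue/aM.
Qed.
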